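(* Suppose $G$ is a closed subset of $[0,1]\times[0,1]$, $\mathbf{G}=\star_{i=1}^\infty G\ne\emptyset$, and $\sigma(\mathbf{G})=\mathbf{G}$. Then for every positive integer $k$, $\operatorname{ent}(\star_{i=1}^kG)=k\,\operatorname{ent}(G)$, where $\star_{i=1}^kG$ is regarded as a closed subset of $[0,1]^{k+1}$.
   Context: Let $I=[0,1]$; open intervals in $I$ are open relative to $I$. A minimal open cover of $I$ by open intervals is a finite collection $\alpha=\{\alpha_1,\dots,\alpha_n\}$ of open intervals covering $I$ such that no subcollection of smaller cardinality covers $I$. For a positive integer $N$, a closed set $H\subset I^{N+1}$ and a positive integer $m$, let $\star_{i=1}^mH=\{(x_0,\dots,x_{mN})\in I^{mN+1}:(x_{(i-1)N},x_{(i-1)N+1},\dots,x_{iN})\in H\text{ for }1\le i\le m\}$, and $\mathbf{H}=\star_{i=1}^\infty H=\{(x_0,x_1,\dots)\in I^\infty:(x_{(i-1)N},\dots,x_{iN})\in H\text{ for all }i\ge1\}$. Let $\alpha^{r}=\{\alpha_{k_0}\times\cdots\times\alpha_{k_{r-1}}:k_j\in\{1,\dots,n\}\}$ and let $N(K,\mathcal U)$ be the least cardinality of a subcollection of $\mathcal U$ covering $K$. If $\mathbf{H}\ne\emptyset$, define $\operatorname{ent}(H,\alpha)=\lim_{m\to\infty}\frac1m\log N(\star_{i=1}^mH,\alpha^{mN+1})$ (the limit exists); if $\mathbf{H}=\emptyset$, define $\operatorname{ent}(H,\alpha)=0$. Then $\operatorname{ent}(H)=\sup_\alpha\operatorname{ent}(H,\alpha)\in[0,\infty]$,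 over all minimal open covers $\alpha$ of $I$ by open intervals. (For $G\subset I\times I$ take $N=1$; for $\star_{i=1}^kG\subset I^{k+1}$ take $N=k$.) The shift map is $\sigma(x_0,x_1,x_2,\dots)=(x_1,x_2,\dots)$. Convention: $k\cdot\infty=\infty$. *)

(* Defs.v *)
From HB Require Import structures.
From mathcomp Require Import all_boot all_order all_algebra finmap.
From mathcomp Require Import all_classical all_reals all_analysis.
Import Order.TTheory GRing.Theory Num.Theory.
Import numFieldNormedType.Exports.

Set Implicit Arguments.
Unset Strict Implicit.
Unset Printing Implicit Defensive.

Local Open Scope classical_set_scope.
Local Open Scope ring_scope.

Section Entropy.
Context {R : realType}.

Definition unitI : set R := `[0, 1]%classic.

Definition cube (r : nat) : set 'rV[R]_r := [set x | forall j, unitI (x ord0 j)].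

(* Relatively open intervals of [0, 1]; the empty set is allowed here but never
   occurs in a minimal cover. *)
Definition open_interval_in_I (A : set R) : Prop :=
  is_interval A /\ exists2 U : set R, open U & A = unitI `&` U.

Definition covers (T : Type) (K : set T) (V : {fset (set T)}) : Prop :=
  K `<=` \bigcup_(A in [set` V]) A.

Definition minimal_open_cover (alpha : {fset (set R)}) : Prop :=
  [/\ forall A, A \in alpha -> open_interval_in_I A,
      covers unitI alpha
    & forall beta : {fset (set R)}, (beta `<=` alpha)%fset ->
        (#|` beta| < #|` alpha|)%N -> ~ covers unitI beta].

Definition box (r : nat) (b : 'I_r -> set R) : set 'rV[R]_r :=
  [set x | forall j, b j (x ord0 j)].

Definition cover_pow (alpha : {fset (set R)}) (r : nat) : set (set 'rV[R]_r) :=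
  [set box b | b in [set b : 'I_r -> set R | forall j, b j \in alpha]].

(* Least cardinality of a subcollection of [U] covering [K]; the value is 0
   when no finite subcollection of [U] covers [K]. *)
Definition cover_number (T : Type) (K : set T) (U : set (set T)) : nat :=
  xget 0%N [set n | (exists V : {fset (set T)},
                       [/\ [set` V] `<=` U, covers K V & #|` V| = n]) /\
                    (forall V : {fset (set T)},
                       [set` V] `<=` U -> covers K V -> (n <= #|` V|)%N)].

(* [i] runs from 0, so the [i]-th window starts at coordinate [i * N]; the
   argument of [inord] is at most [m * N], so [inord] never truncates. *)
Definition star (N m : nat) (H : set 'rV[R]_N.+1) : set 'rV[R]_(m * N).+1 :=
  [set x | cube x /\
    forall i : 'I_m, H (\row_(j < N.+1) x ord0 (inord (i * N + j)%N))].

Definition star_infty (N : nat) (H : set 'rV[R]_N.+1) : set (nat -> R) :=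
  [set x | (forall n, unitI (x n)) /\
    forall i : nat, H (\row_(j < N.+1) x (i * N + j)%N)].

Definition shift_map (x : nat -> R) : nat -> R := fun n => x n.+1.

(* The limit is taken in R; it exists whenever [H] is a closed subset of
   [cube N.+1] and [star_infty H] is nonempty. The term at [m = 0] is
   irrelevant. *)
Definition ent_cover (N : nat) (H : set 'rV[R]_N.+1) (alpha : {fset (set R)}) : R :=
  if `[< star_infty H = set0 >] then 0
  else limn (fun m : nat => m%:R^-1 *
    ln (cover_number (@star N m H) (@cover_pow alpha (m * N).+1))%:R : R).

Definition ent (N : nat) (H : set 'rV[R]_N.+1) : \bar R :=
  ereal_sup [set (ent_cover H alpha)%:E | alpha in minimal_open_cover].

End Entropy.

Arguments cube {R} r.
Arguments cover_pow {R} alpha r.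
Arguments star {R} N m H.
Arguments ent {R} N H.

(* Main.v *)
Require Import Defs.
From mathcomp Require Import all_boot all_order all_algebra finmap.
From mathcomp Require Import all_classical all_reals all_analysis.
Import Order.TTheory GRing.Theory Num.Theory.
Import numFieldNormedType.Exports.
Local Open Scope classical_set_scope.
Local Open Scope ring_scope.

(** Fix a cover [alpha] and write [c m] for the number of boxes with sides in
    [alpha] needed to cover [star N m H].

    The entropy scales because iterating [star] only regroups windows:
    a point belongs to the [m]-fold star of [star N k H] exactly when it belongs
    to the [(m * k)]-fold star of [H] ([star_star_prefix]).  Hence the covering
    numbers of [star N k H] are [c (m * k)], and
      [ln (c (m * k)) / m = k * (ln (c (m * k)) / (m * k))]
    runs along a subsequence of the sequence that defines the entropy of [H],
    multiplied by [k].

    For this to give the factor [k] in the limit, the whole sequence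
    [ln (c m) / m] has to converge.  A point of the [(m + n)]-fold star splits
    into a point of the [m]-fold star and one of the [n]-fold star that share the
    coordinate [m * N].  Gluing a box of the first cover to a box of the second,
    and keeping only the first box's condition on the shared coordinate, gives a
    box of the product cover, so [c (m + n) <= c m * c n]
    ([cover_number_starD]).  As [star_infty H] is nonempty, [1 <= c m], and
    Fekete's lemma applies to the nonnegative subadditive sequence [ln (c m)]
    ([cvg_ent_cover]).

    The factor then commutes with the supremum over [alpha] because it is
    positive. *)

(** * Fekete's subadditive lemma *)

Section Fekete.
Context {R : realType} (a : nat -> R).
Hypothesis a_ge0 : forall n, 0 <= a n.
Hypothesis a_subadd : forall m n, a (m + n)%N <= a m + a n.

Lemma subadditive_mulnD m q r : a (q * m + r)%N <= q%:R * a m + a r.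
Proof.
elim: q => [|q IHq]; first by rewrite mul0n mul0r add0n add0r.
rewrite mulSn -addnA (le_trans (a_subadd _ _))//.
by rewrite -natr1 mulrDl mul1r [q%:R * _ + _]addrC -addrA lerD2l.
Qed.

(** Any ratio [a m / m] close to the infimum controls all later ratios: Euclidean
    division of [n] by [m] bounds [a n] by [(n %/ m) * a m] plus a term that
    takes finitely many values and so vanishes after division by [n]. *)
Lemma fekete : (fun n => n%:R^-1 * a n) @ \oo -->
  inf [set n%:R^-1 * a n | n in [set n | (0 < n)%N]].
Proof.
set E := [set _ | _ in _].
have Eb : has_lbound E.
  by exists 0 => _ [n _ <-]; rewrite mulr_ge0// invr_ge0.
have Einf : has_inf E by split=> //; exists (1%:R^-1 * a 1%N), 1%N.
apply/cvgrPdist_le => e e0.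
have e20 : 0 < e / 2 by rewrite divr_gt0.
have [_ [m /= m0 <-] mE] := inf_adherent e20 Einf.
pose M := \big[Order.max/0]_(i < m) a i.
near=> n.
have n0 : (0 < n)%N by near: n; exists 1%N.
have n0R : 0 < n%:R :> R by rewrite ltr0n.
have EL : inf E <= n%:R^-1 * a n by apply: ge_inf => //; exists n.
rewrite distrC ger0_norm ?subr_ge0// lerBlDl.
suff anM : n%:R^-1 * a n <= m%:R^-1 * a m + e / 2.
  rewrite (le_trans anM)//.
  by rewrite [in leRHS](splitr e) addrA lerD2r ltW.
rewrite ler_pdivrMl//.
have anE : a n <= (n %/ m)%:R * a m + M.
  rewrite {1}(divn_eq n m) (le_trans (subadditive_mulnD _ _ _))// lerD2l.
  have rm : (n %% m < m)%N by rewrite ltn_mod.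
  exact: (le_bigmax 0 (fun i : 'I_m => a i) (Ordinal rm)).
rewrite (le_trans anE)// mulrDr lerD//.
  rewrite mulrA ler_wpM2r// ler_pdivlMr ?ltr0n//.
  by rewrite -natrM ler_nat leq_divM.
rewrite -ler_pdivrMr//.
by near: n; exact: nbhs_infty_ger.
Unshelve. all: by end_near. Qed.

End Fekete.

(** * Covering numbers *)

Section CoverNumber.
Context {T : Type} (K : set T) (U : set (set T)).
Hypothesis U_covers : exists2 V : {fset (set T)}, [set` V] `<=` U & covers K V.

(** As soon as some finite subcollection of [U] covers [K], the default value of
    [cover_number] is not used and the number is a genuine minimum. *)
Lemma cover_numberP :
  (exists V : {fset (set T)},
     [/\ [set` V] `<=` U, covers K V & #|` V| = cover_number K U]) /\
  (forall V : {fset (set T)},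
     [set` V] `<=` U -> covers K V -> (cover_number K U <= #|` V|)%N).
Proof.
pose P n := `[< exists V : {fset (set T)},
  [/\ [set` V] `<=` U, covers K V & #|` V| = n] >].
have exP : exists n, P n.
  by have [V VU KV] := U_covers; exists #|` V|; apply/asboolP; exists V.
rewrite /cover_number; set S := [set n | _].
apply: (@xgetPex _ 0%N S).
exists (ex_minn exP); case: ex_minnP => n /asboolP nP nmin; split=> // V VU KV.
by apply: nmin; apply/asboolP; exists V.
Qed.

(** The sets of [W] may be smaller than members of [U], and [W] may repeat them:
    choosing a member of [U] around each only enlarges the union.  This allows
    bounding a covering number with sets that are not exactly boxes. *)
Lemma cover_number_le_size (W : seq (set T)) :
  K `<=` \bigcup_(A in [set` W]) A ->
  (forall A, A \in W -> exists2 B, U B & A `<=` B) ->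
  (cover_number K U <= size W)%N.
Proof.
move=> KW WU.
have /choice[g gP] : forall A, exists B, A \in W -> U B /\ A `<=` B.
  move=> A; have [AW|_] := boolP (A \in W); last by exists A.
  by have [B UB AB] := WU A AW; exists B.
pose V := seq_fset tt (map g W).
have gV : #|` V|%N = size (undup (map g W)) := size_seq_fset tt _.
apply: (@leq_trans #|` V|); last first.
  by rewrite gV (leq_trans (size_undup _))// size_map.
apply: cover_numberP.2.
  by move=> B /=; rewrite seq_fsetE => /mapP[A AW ->]; exact: (gP A AW).1.
move=> x /KW[A /= AW Ax]; exists (g A); last exact: (gP A AW).2.
by rewrite /= seq_fsetE map_f.
Qed.

Lemma cover_number_gt0 : K !=set0 -> (0 < cover_number K U)%N.
Proof.
move=> [x Kx]; have [[V [_ KV <-]] _] := cover_numberP.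
by have [A AV _] := KV x Kx; rewrite cardfs_gt0; apply/fset0Pn; exists A.
Qed.

End CoverNumber.

(** * Points of stars as prefixes of sequences *)

Section Prefix.
Context {R : realType}.

(** Row vectors are handled as prefixes of real sequences, so that windows and
    concatenations are computed on natural number indices, and equations such as
    [m * (k * N) = m * k * N] between dimensions need no transport of vectors. *)
Definition prefix_row r (x : nat -> R) : 'rV[R]_r := \row_(j < r) x j.

Lemma prefix_row_inord r (y : 'rV[R]_r.+1) :
  y = prefix_row r.+1 (fun n => y ord0 (inord n)).
Proof. by apply/rowP => j; rewrite mxE inord_val. Qed.

Lemma box_prefix r (b : 'I_r -> set R) x :
  box b (prefix_row r x) <-> forall j : 'I_r, b j (x j).
Proof. by split=> bx j; have := bx j; rewrite mxE. Qed.

Lemma cube_prefix r x :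
  cube r (prefix_row r x) <-> forall j, (j < r)%N -> unitI (x j).
Proof.
split=> [cx j jr|cx j]; last by rewrite mxE; exact: cx.
by have := cx (Ordinal jr); rewrite mxE.
Qed.

Lemma star_prefix N m (H : set 'rV[R]_N.+1) x :
  star N m H (prefix_row _ x) <->
  (forall j, (j <= m * N)%N -> unitI (x j)) /\
  (forall i, (i < m)%N -> H (prefix_row _ (fun j => x (i * N + j)%N))).
Proof.
have winE (i : 'I_m) : \row_(j < N.+1)
    (prefix_row (m * N).+1 x) ord0 (inord (i * N + j)) =
    prefix_row N.+1 (fun j => x (i * N + j)%N).
  apply/rowP => j; rewrite !mxE inordK// ltnS.
  rewrite (@leq_trans (i.+1 * N)) ?leq_mul2r ?ltn_ord ?orbT//.
  by rewrite mulSn addnC leq_add2r -ltnS.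
rewrite /star /= cube_prefix; split=> -[cx Hx]; split=> // i.
  by move=> im; have := Hx (Ordinal im); rewrite winE.
by rewrite winE; exact: Hx.
Qed.

Lemma star_infty_prefix {N} {H : set 'rV[R]_N.+1} {x} m :
  star_infty H x -> star N m H (prefix_row _ x).
Proof.
by move=> [xI xH]; apply/star_prefix; split=> [j _|i _]; [exact: xI|exact: xH].
Qed.

Lemma star_sub_cube N m (H : set 'rV[R]_N.+1) : star N m H `<=` cube _.
Proof. by move=> x []. Qed.

(** Two sets whose dimensions are only provably equal have the same covering
    numbers if they contain the prefixes of the same sequences. *)
Lemma cover_number_cast (alpha : {fset (set R)}) {r s} (rs : r = s)
    (K : set 'rV[R]_r.+1) (L : set 'rV[R]_s.+1) :
  (forall x, K (prefix_row _ x) <-> L (prefix_row _ x)) ->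
  cover_number K (cover_pow alpha r.+1) = cover_number L (cover_pow alpha s.+1).
Proof.
case: s / rs L => L KL; congr cover_number; apply/seteqP.
by split=> y; rewrite (prefix_row_inord _ y) => /KL.
Qed.

(** * Submultiplicativity of covering numbers *)

Section Cover.
Context {alpha : {fset (set R)}}.
Hypothesis alphaI : covers unitI alpha.

(** [alpha] being finite, so is the family of all boxes with sides in [alpha];
    it covers the cube because the sides can be chosen one coordinate at a time. *)
Lemma cover_pow_covers r (K : set 'rV[R]_r) : K `<=` cube r ->
  exists2 V : {fset (set 'rV[R]_r)}, [set` V] `<=` cover_pow alpha r & covers K V.
Proof.
move=> Kc.
pose f (b : {ffun 'I_r -> alpha}) := box (fun j => fsval (b j)).
pose V := seq_fset tt (map f (enum {: {ffun 'I_r -> alpha}})); exists V.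
  move=> A /=; rewrite seq_fsetE => /mapP[b _ ->].
  by exists (fun j => fsval (b j)) => //= j; exact: fsvalP.
move=> x /Kc xI.
have /choice[b bP] : forall j, exists B : alpha, fsval B (x ord0 j).
  by move=> j; have [A /= Aa Ax] := alphaI _ (xI j); exists [` Aa]%fset.
exists (f (finfun b)); first by rewrite /= seq_fsetE map_f// mem_enum.
by move=> j; rewrite ffunE.
Qed.

(** The prefixes in [K1] and [K2] overlap in coordinate [p], where a glued set
    imposes two conditions and thus is in general no box of the product cover.
    It is contained in one, obtained by forgetting the second condition. *)
Lemma cover_number_concat r p q (rpq : r = (p + q)%N) (K : set 'rV[R]_r.+1)
    (K1 : set 'rV[R]_p.+1) (K2 : set 'rV[R]_q.+1) :
  K `<=` cube _ -> K1 `<=` cube _ -> K2 `<=` cube _ ->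
  (forall x, K (prefix_row _ x) ->
    K1 (prefix_row _ x) /\ K2 (prefix_row _ (fun n => x (p + n)%N))) ->
  (cover_number K (cover_pow alpha r.+1) <=
   cover_number K1 (cover_pow alpha p.+1) *
   cover_number K2 (cover_pow alpha q.+1))%N.
Proof.
move: K; rewrite {r}rpq => K Kc K1c K2c K12.
have [[V1 [V1U K1V1 <-]] _] := cover_numberP _ _ (cover_pow_covers _ _ K1c).
have [[V2 [V2U K2V2 <-]] _] := cover_numberP _ _ (cover_pow_covers _ _ K2c).
pose glue (A : set 'rV[R]_p.+1) (B : set 'rV[R]_q.+1) : set 'rV[R]_(p + q).+1 :=
  [set prefix_row _ x | x in [set x | A (prefix_row _ x) /\
                                      B (prefix_row _ (fun n => x (p + n)%N))]].
rewrite -(size_allpairs glue); apply: cover_number_le_size.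
- exact: cover_pow_covers.
- move=> y; rewrite (prefix_row_inord _ y); set x := fun _ => _ => Kx.
  have [/K1V1[A AV Ax] /K2V2[B BV Bx]] := K12 x Kx.
  exists (glue A B); first by apply/allpairsP; exists (A, B).
  by exists x.
- move=> _ /allpairsP[[A B] /= [AV BV ->]].
  have [b ba <-] := V1U _ AV; have [c ca <-] := V2U _ BV.
  exists (box (fun j : 'I_(p + q).+1 =>
    if (j <= p)%N then b (inord j) else c (inord (j - p)))).
    by eexists; last reflexivity; move=> j /=; case: ifP.
  move=> _ [x [/box_prefix bx /box_prefix cx] <-]; apply/box_prefix => j.
  case: leqP => jp; first by have := bx (inord j); rewrite inordK.
  have := cx (inord (j - p)%N); rewrite inordK ?subnKC//; first exact: ltnW.
  by rewrite ltnS leq_subLR -ltnS.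
Qed.

Section StarCounting.
Context {N : nat} {H : set 'rV[R]_N.+1} (H_neq0 : star_infty H !=set0).

Let count m := cover_number (star N m H) (cover_pow alpha (m * N).+1).

Lemma cover_number_star_gt0 m : (0 < count m)%N.
Proof.
have [x Hx] := H_neq0; apply: cover_number_gt0.
  exact/cover_pow_covers/star_sub_cube.
by exists (prefix_row _ x); exact: star_infty_prefix.
Qed.

Lemma cover_number_starD m n : (count (m + n) <= count m * count n)%N.
Proof.
apply: (cover_number_concat _ (m * N) (n * N)); rewrite ?mulnDl//;
  try exact: star_sub_cube.
move=> x /star_prefix[xI xH]; split; apply/star_prefix; split.
- by move=> j jm; apply: xI; rewrite mulnDl (leq_trans jm)// leq_addr.
- by move=> i im; apply: xH; rewrite (leq_trans im)// leq_addr.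
- by move=> j jn; apply: xI; rewrite mulnDl leq_add2l.
- move=> i iN; have := xH (m + i)%N; rewrite ltn_add2l => /(_ iN).
  by congr H; apply/rowP => j; rewrite !mxE mulnDl addnA.
Qed.

(** [ent_cover] is defined with a total limit operator; this is where the limit
    is shown to exist. *)
Lemma cvg_ent_cover :
  (fun m : nat => m%:R^-1 * ln (count m)%:R : R) @ \oo --> ent_cover H alpha.
Proof.
rewrite /ent_cover asboolF; last by move/eqP; exact/negP/set0P.
suff /cvgP : (fun m : nat => m%:R^-1 * ln (count m)%:R : R) @ \oo -->
  inf [set (n%:R^-1 * ln (count n)%:R : R) | n in [set n | (0 < n)%N]] by [].
apply: (fekete (fun m => ln (count m)%:R)) => [n|m n].
  by rewrite ln_ge0// ler1n cover_number_star_gt0.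
rewrite -lnM ?posrE ?ltr0n ?cover_number_star_gt0//.
rewrite ler_ln ?posrE -?natrM ?ltr0n ?muln_gt0 ?cover_number_star_gt0//.
by rewrite ler_nat cover_number_starD.
Qed.

End StarCounting.
End Cover.

(** * Stars of stars *)

Section Iterate.
Context {N k : nat} {H : set 'rV[R]_N.+1} (k_gt0 : (0 < k)%N).

(** The [i]-th window of [H] along [x] is the window number [i %% k] inside the
    window number [i %/ k] of [star N k H]. *)
Lemma star_star_prefix m x :
  star (k * N) m (star N k H) (prefix_row _ x) <->
  star N (m * k) H (prefix_row _ x).
Proof.
rewrite !star_prefix mulnA; split=> -[xI xH]; split=> //.
- move=> i imk; have ik : (i %/ k < m)%N by rewrite ltn_divLR.
  have /star_prefix[_ /(_ (i %% k)%N)] := xH _ ik.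
  rewrite ltn_mod => /(_ k_gt0); congr H; apply/rowP => j.
  by rewrite !mxE mulnA addnA -mulnDl -divn_eq.
- move=> i im; have imk : (i.+1 * k <= m * k)%N by rewrite leq_mul2r im orbT.
  apply/star_prefix; split.
    move=> j jk; apply: xI; rewrite (@leq_trans (i.+1 * k * N))//.
      by rewrite -mulnA mulSn addnC leq_add2r.
    by rewrite leq_mul2r imk orbT.
  move=> l lk; have lmk : (i * k + l < m * k)%N.
    by rewrite (leq_trans _ imk)// mulSn addnC ltn_add2r.
  by have := xH _ lmk; congr H; apply/rowP => j; rewrite !mxE mulnDl addnA mulnA.
Qed.

Hypothesis H_neq0 : star_infty H !=set0.

Lemma star_infty_star_neq0 : star_infty (star N k H) !=set0.
Proof.
have [x [xI xH]] := H_neq0; exists x; split=> // i.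
apply: (@star_infty_prefix N H (fun j => x (i * (k * N) + j)%N)).
split=> // l; have := xH (i * k + l)%N.
by congr H; apply/rowP => j; rewrite !mxE mulnDl addnA mulnA.
Qed.

Lemma ent_cover_star (alpha : {fset (set R)}) : covers unitI alpha ->
  ent_cover (star N k H) alpha = k%:R * ent_cover H alpha.
Proof.
move=> alphaI; have entH := cvg_ent_cover alphaI H_neq0.
have entHk := cvg_ent_cover alphaI star_infty_star_neq0.
apply: (cvg_unique _ entHk); first exact: norm_hausdorff.
apply: cvg_trans
  (cvgMl_tmp (a := k%:R) (cvg_comp _ _ (cvg_mulnr k k_gt0) entH)).
apply: near_eq_cvg; apply: nearW => m /=.
rewrite (cover_number_cast alpha (mulnA m k N) _ _ (star_star_prefix m)).
have k0 : k%:R != 0 :> R by rewrite pnatr_eq0 -lt0n.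
by rewrite natrM invfM mulrA mulrCA mulfV// mulr1.
Qed.

Lemma ent_star : ent (k * N) (star N k H) = (k%:R%:E * ent N H)%E.
Proof.
rewrite /ent -ereal_sup_pZl ?ltr0n// image_comp; congr ereal_sup.
by apply: eq_imagel => alpha [_ alphaI _] /=; rewrite ent_cover_star// EFinM.
Qed.

End Iterate.
End Prefix.

Theorem theorem15 (R : realType) (G : set 'rV[R]_2)
    (closedG : closed G) (subG : G `<=` cube 2)
    (G_neq0 : star_infty G !=set0)
    (shiftG : shift_map @` star_infty G = star_infty G)
    (k : nat) (k_gt0 : (0 < k)%N) :
  ent (k * 1) (star 1 k G) = (k%:R%:E * ent 1 G)%E.
Proof. exact: ent_star. Qed.
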